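(* Let $A_\bullet=(A_k)_{k=0}^\infty$ be a sequence of matrices in $\mathbb{C}^{d\times d}$ and $S\in\mathbb{C}^{d\times d}$. If $\sum_{k=0}^\infty A_k$ is weakly Borel summable to $S$, then it is strongly Borel summable to $S$. The converse holds if and only if $\lim_{x\to\infty}e^{-x}\mathscr{SB}(A_\bullet)(x)=0$; that is, if $\sum_{k=0}^\infty A_k$ is strongly Borel summable to $S$, then it is weakly Borel summable to $S$ if and only if $\lim_{x\to\infty}e^{-x}\mathscr{SB}(A_\bullet)(x)=0$.
   Context: A series of matrices is conventionally summable if its partial sums converge in any matrix norm. With $S_n=\sum_{k=0}^nA_k$, the weak and strong Borel transforms of $A_\bullet$ are, for $x>0$, $$\mathscr{WB}(A_\bullet)(x)=\sum_{k=0}^\infty S_k\frac{x^k}{k!},\qquad\mathscr{SB}(A_\bullet)(x)=\sum_{k=0}^\infty A_k\frac{x^k}{k!}.$$ The series $\sum_{k=0}^\infty A_k$ is weakly Borel summable to $S$ if the series $e^{-x}\mathscr{WB}(A_\bullet)(x)$ is conventionally summable for all $x>0$ and $\lim_{x\to\infty}e^{-x}\mathscr{WB}(A_\bullet)(x)=S$. It is strongly Borel summable to $S$ if $\int_0^xe^{-t}\mathscr{SB}(A_\bullet)(t)\,dt$ is well defined, with the series $\mathscr{SB}(A_\bullet)$ conventionally summable, for all $x>0$, and $\int_0^\infty e^{-x}\mathscr{SB}(A_\bullet)(x)\,dx=\lim_{x\to\infty}\int_0^xe^{-t}\mathscr{SB}(A_\bullet)(t)\,dt=S$. *)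

(* Defs.v *)
From HB Require Import structures.
From mathcomp Require Import all_boot all_order all_algebra.
From mathcomp Require Import all_classical all_reals all_analysis.
From mathcomp Require Import complex.

Set Implicit Arguments.
Unset Strict Implicit.
Unset Printing Implicit Defensive.

Import Order.TTheory GRing.Theory Num.Theory.
Import numFieldNormedType.Exports.

Local Open Scope classical_set_scope.
Local Open Scope complex_scope.
Local Open Scope ring_scope.

(* The library puts its topology and norm on abstract numeric fields only; this
   gives the concrete field [R[i]] the same structures, with the modulus as
   norm. *)
HB.instance Definition _ (R : realType) := NormedModule.copy R[i] R[i]^o.

(* Limits in ['M[R[i]]_d] are taken for the topology of the entrywise sup norm,
   which on this finite-dimensional space is the topology of every norm. *)

Section borel_summability.
Context {R : realType} {d : nat}.
Implicit Types (A : nat -> 'M[R[i]]_d) (S : 'M[R[i]]_d) (x : R).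

(* [series] sums over indices < n, so its nth term is the partial sum S_{n-1}. *)
Definition summable_mx A : Prop := cvgn (series A).

Definition sum_mx A : 'M[R[i]]_d := limn (series A).

Definition partial_sum A (n : nat) : 'M[R[i]]_d := \sum_(k < n.+1) A k.

Definition borel_term A x (k : nat) : 'M[R[i]]_d :=
  (x ^+ k / k`!%:R)%:C *: A k.

Definition weak_borel A x : 'M[R[i]]_d :=
  sum_mx (borel_term (partial_sum A) x).

Definition strong_borel A x : 'M[R[i]]_d := sum_mx (borel_term A x).

Definition integrable_mx (D : set R) (F : R -> 'M[R[i]]_d) : Prop :=
  forall i j,
    lebesgue_measure.-integrable D (fun t => (complex.Re (F t i j))%:E) /\
    lebesgue_measure.-integrable D (fun t => (complex.Im (F t i j))%:E).

Definition integral_mx (D : set R) (F : R -> 'M[R[i]]_d) : 'M[R[i]]_d :=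
  \matrix_(i, j)
    ((\int[lebesgue_measure]_(t in D) complex.Re (F t i j)) +i*
     (\int[lebesgue_measure]_(t in D) complex.Im (F t i j))).

Definition weakly_borel_summable A S : Prop :=
  (forall x, 0 < x -> summable_mx
     (fun k => (expR (- x))%:C *: borel_term (partial_sum A) x k)) /\
  (expR (- x))%:C *: weak_borel A x @[x --> +oo] --> S.

Definition strongly_borel_summable A S : Prop :=
  [/\ forall x, 0 < x -> summable_mx (borel_term A x),
      forall x, 0 < x ->
        integrable_mx `[0, x] (fun t => (expR (- t))%:C *: strong_borel A t) &
      integral_mx `[0, x] (fun t => (expR (- t))%:C *: strong_borel A t)
        @[x --> +oo] --> S].

End borel_summability.

(* Main.v *)
Require Import Defs.
From mathcomp Require Import all_boot all_order all_algebra.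
From mathcomp Require Import all_classical all_reals all_analysis.
From mathcomp Require Import complex ring.
Import Order.TTheory GRing.Theory Num.Theory.
Import numFieldNormedType.Exports.
Local Open Scope classical_set_scope.
Local Open Scope complex_scope.
Local Open Scope ring_scope.

(** Taking real and imaginary parts of the matrix entries reduces everything to
    a real sequence [u].  Write [B], [W] and [D] for the exponential generating
    functions of [u], of its partial sums [s_k = u_0 + ... + u_k], and of the
    shifted partial sums [s_(k-1)] (with [s_(-1) = 0]).  Shifting a sequence
    amounts to differentiating its generating function, and
    [u_k = s_k - s_(k-1)], so that [D' = W] and [B = W - D].  Hence
    [(e^(-x) D)' = e^(-x) (W - D) = e^(-x) B], and as [D 0 = 0],
<<
   integral of e^(-t) B(t) over [0, x]
     = e^(-x) D(x) = e^(-x) W(x) - e^(-x) B(x).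
>>
    This identity ([Rintegral_borel]) gives at once the equivalence for a
    strongly summable series: the two transforms differ by [e^(-x) B(x)].  That
    weak summability implies strong summability is the statement that
    [e^(-x) D'(x) --> l] implies [e^(-x) D(x) --> l], an instance of L'Hopital's
    rule since [e^(-x) D(x)] is the quotient of [D] by the exponential, which
    tends to infinity ([cvg_expRM_derive]).

    All this presupposes that the three series converge everywhere, although
    either notion of summability only provides one of them.  Convergence of a
    power series at all positive points means that its coefficients decay faster
    than any geometric sequence ([entire]); this property allows termwise
    differentiation, and it passes from [u] to its partial sums and back
    ([entire_egf_seriesS]). *)

Set Implicit Arguments.
Unset Strict Implicit.
Unset Printing Implicit Defensive.

(** * Convergence of complex matrices *)

Lemma cvg_mxP (U : topologicalType) (I : Type) (F : set_system I)
    (FF : Filter F) m n (f : I -> 'M[U]_(m, n)) (M : 'M[U]_(m, n)) :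
  f @ F --> M <-> forall i j, f x i j @[x --> F] --> M i j.
Proof.
split=> [fM i j P MP|fM A [P MP sP]].
  (* The product neighbourhood that constrains only the entry (i, j). *)
  pose Q i' j' := if (i' == i) && (j' == j) then P else setT.
  have /fM : nbhs M [set N | forall i' j', Q i' j' (N i' j')].
    exists Q => [i' j'|//].
    by rewrite /Q; case: ifP => [/andP[/eqP-> /eqP->]//|_]; exact: filterT.
  apply: (@filterS _ F) => x /(_ i j).
  by rewrite /Q !eqxx.
have : \forall x \near F, forall i j, P i j (f x i j).
  by apply: filter_forall => i; apply: filter_forall => j; exact: fM.
by apply: filterS => x /sP.
Qed.

Lemma normc_i (R : rcfType) : `|'i%C| = 1 :> R[i].
Proof. by rewrite normc_def /= expr0n expr1n add0r sqrtr1. Qed.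

Lemma normc_ge_Im (R : rcfType) (z : R[i]) : `|complex.Im z|%:C <= `|z|.
Proof.
by rewrite -normrN -ReiNIm (le_trans (normc_ge_Re _))// normrM normc_i mulr1.
Qed.

Lemma normc_le_ReIm (R : rcfType) (z : R[i]) :
  `|z| <= (`|complex.Re z| + `|complex.Im z|)%:C.
Proof.
rewrite {1}(complexE z) (le_trans (ler_normD _ _))// normrM normc_i mul1r.
by rewrite !normc_def /= !expr0n /= !addr0 !sqrtr_sqr rmorphD.
Qed.

Lemma cvg_complexP (R : realType) (I : Type) (F : set_system I)
    (FF : Filter F) (f : I -> R[i]) (l : R[i]) :
  f @ F --> l <-> (complex.Re (f x) @[x --> F] --> complex.Re l) /\
                  (complex.Im (f x) @[x --> F] --> complex.Im l).
Proof.
split=> [/cvgrPdist_lt fl|[/cvgrPdist_lt reF /cvgrPdist_lt imF]].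
  split; apply/cvgrPdist_lt => e e0.
    have /fl : 0 < e%:C by rewrite ltcR.
    apply: filterS => x; rewrite -ltcR; apply: le_lt_trans.
    by rewrite -raddfB normc_ge_Re.
  have /fl : 0 < e%:C by rewrite ltcR.
  apply: filterS => x; rewrite -ltcR; apply: le_lt_trans.
  by rewrite -raddfB normc_ge_Im.
apply/cvgrPdist_lt => -[e b] /[dup]; rewrite {1}ltcE/= => /andP[/eqP -> e0] _.
have e20 : 0 < e / 2 by rewrite divr_gt0.
near=> x; apply: le_lt_trans (normc_le_ReIm _) _.
rewrite ltcR [e]splitr ltrD// raddfB.
- by near: x; exact: reF.
- by near: x; exact: imF.
Unshelve. all: by end_near. Qed.

(** * Power series with infinite radius of convergence *)

Section PowerSeries.
Variable R : realType.
Implicit Types (c a u : R^nat) (x y : R).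

(** These are the Taylor coefficients of entire functions.  The bound is used
    rather than convergence because it is stable under the operations below by
    direct estimates. *)
Definition entire c :=
  forall y, 0 < y -> exists C, forall k, `|c k| * y ^+ k <= C.

Lemma cvg_entire c : (forall x, 0 < x -> cvgn (pseries c x)) -> entire c.
Proof.
move=> cc y y0; have [K [Kreal Kc]] := cvg_series_bounded (cc _ y0).
exists (K + 1) => k; have := Kc (K + 1); rewrite ltrDl ltr01 => /(_ isT k I).
by rewrite /= normrM normrX (gtr0_norm y0).
Qed.

(** Bounding the coefficients at twice the radius dominates the series by a
    geometric one of ratio 1/2. *)
Lemma entire_cvg c x : entire c -> cvgn (pseries c x).
Proof.
move=> ec; have y0 : 0 < 2 * (`|x| + 1) by rewrite mulr_gt0// ltr_wpDl.
have [C cC] := ec _ y0.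
apply: normed_cvg; apply: (@series_le_cvg _ _ (geometric C 2^-1)).
- by move=> k /=; rewrite normr_ge0.
- by move=> k /=; rewrite mulr_ge0// (le_trans _ (cC 0%N))// mulr_ge0.
- move=> k /=; rewrite exprVn ler_pdivlMr ?exprn_gt0// normrM normrX.
  apply: le_trans (cC k); rewrite -mulrA ler_wpM2l// exprMn mulrC ler_wpM2l//.
  by rewrite lerXn2r ?nnegrE ?addr_ge0// lerDl.
apply: is_cvg_geometric_series.
by rewrite ger0_norm ?invr_ge0// invf_lt1// ltr1n.
Qed.

(** The factor [k.+1] is absorbed by [2 ^ k.+1], that is by doubling the
    radius. *)
Lemma entire_pseries_diffs c : entire c -> entire (pseries_diffs c).
Proof.
move=> ec y y0; have [C cC] := ec _ (mulr_gt0 (ltr0Sn R 1) y0).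
exists (C / y) => k; rewrite ler_pdivlMr//; apply: le_trans (cC k.+1).
rewrite /pseries_diffs normrM normr_nat -mulrA -exprSr -mulrA mulrCA ler_wpM2l//.
rewrite exprMn ler_wpM2r ?exprn_ge0 1?ltW// -natrX ltr_nat.
exact: ltn_expl.
Qed.

Lemma entireB c c' : entire c -> entire c' -> entire (fun k => c k - c' k).
Proof.
move=> ec ec' y y0; have [C cC] := ec _ y0; have [C' cC'] := ec' _ y0.
exists (C + C') => k; apply: le_trans (lerD (cC k) (cC' k)).
by rewrite -mulrDl ler_wpM2r ?ler_normB// exprn_ge0// ltW.
Qed.

Lemma is_derive_pseries c x : entire c ->
  is_derive x 1 (fun x => limn (pseries c x))
    (limn (pseries (pseries_diffs c) x)).
Proof.
move=> ec; have ec' := entire_pseries_diffs ec.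
apply: (@pseries_snd_diffs _ _ (`|x| + 1)); do ?exact: entire_cvg.
  exact/entire_cvg/entire_pseries_diffs.
by rewrite [ltRHS]ger0_norm ?ltrDl// addr_ge0.
Qed.

Lemma pseries0 c : limn (pseries c 0) = c 0%N.
Proof.
apply: cvg_lim => //; rewrite -cvg_shiftS; apply: cvg_near_cst; apply: nearW => n.
rewrite /pseries /series /= big_nat_recl//= expr0 mulr1 big1 ?addr0// => i _.
by rewrite exprS mul0r mulr0.
Qed.

(** * Exponential generating functions *)

Definition egf u : R^nat := fun k => u k / k`!%:R.
Definition borel u x : R := limn (pseries (egf u) x).

Lemma pseries_diffs_egf u : pseries_diffs (egf u) = egf (fun k => u k.+1).
Proof.
apply/funext => k; rewrite /pseries_diffs /egf factS natrM invfM.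
by rewrite mulrCA mulVKf// pnatr_eq0.
Qed.

(** [(u_(k+1) x^(k+1) / (k+1)!)' = u_(k+1) x^k / k!]. *)
Lemma is_derive_borel u x : entire (egf u) ->
  is_derive x 1 (borel u) (borel (fun k => u k.+1) x).
Proof.
by move=> eu; rewrite /borel -pseries_diffs_egf; exact: is_derive_pseries.
Qed.

(** Undoing a shift is a termwise integration, which multiplies the bound by
    [y / k.+1]. *)
Lemma entire_egf_shift u : entire (egf (fun k => u k.+1)) -> entire (egf u).
Proof.
move=> eu y y0; have [C uC] := eu _ y0; have y_ge0 := ltW y0.
have C0 : 0 <= C by apply: le_trans (uC 0%N); rewrite mulr_ge0.
exists (`|u 0%N| + C * y) => -[|k].
  by rewrite /egf fact0 divr1 expr0 mulr1 lerDl mulr_ge0.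
rewrite ler_wpDl// exprSr mulrA ler_wpM2r//; apply: le_trans (uC k).
rewrite ler_wpM2r ?exprn_ge0// /egf !normrM ler_wpM2l// !ger0_norm ?invr_ge0//.
by rewrite lef_pV2 ?posrE ?ltr0n ?fact_gt0// ler_nat leq_pmull// fact_gt0.
Qed.

(** Let [T_n = |s_n| y^n / n!] with [s_n] the sum of the first [n] terms, and
    let [C] bound [|u_n| y^n / n!].  Then [T_(n+1) <= (T_n + C) y / (n+1)], and
    induction gives [T_n + C <= C * (1 + y + ... + y^n / n!) <= C e^y]. *)
Lemma entire_egf_series u : entire (egf u) -> entire (egf (series u)).
Proof.
move=> eu y y0; have [C uC] := eu _ y0; have y_ge0 := ltW y0.
have C0 : 0 <= C by apply: le_trans (uC 0%N); rewrite mulr_ge0.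
exists (C * expR y) => n.
apply: (@le_trans _ _ (C * series (exp_coeff y) n.+1)); last first.
  rewrite ler_wpM2l//; apply: nondecreasing_cvgn_le.
    by apply: nondecreasing_series => k _ _; exact: exp_coeff_ge0.
  exact: is_cvg_series_exp_coeff.
suff : `|egf (series u) n| * y ^+ n + C <= C * series (exp_coeff y) n.+1.
  by apply: le_trans; rewrite lerDl.
elim: n => [|n IHn].
  rewrite /egf /series /= big_nil mul0r normr0 mul0r add0r big_nat1.
  by rewrite /exp_coeff /= expr0 fact0 divr1 mulr1.
have -> : series (exp_coeff y) n.+2 =
    1 + \sum_(0 <= k < n.+1) exp_coeff y k * (y / k.+1%:R).
  rewrite /series /= big_nat_recl//= /exp_coeff /= expr0 fact0 divr1.
  congr (_ + _); apply: eq_bigr => k _; rewrite factS natrM exprS invfM.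
  by rewrite mulrACA mulrC [_ / _.+1%:R]mulrC.
rewrite mulrDr mulr1 [leRHS]addrC lerD2r.
have yn0 : 0 <= y / n.+1%:R by rewrite divr_ge0.
apply: (@le_trans _ _ (C * series (exp_coeff y) n.+1 * (y / n.+1%:R))); last first.
  rewrite -mulrA ler_wpM2l// mulr_suml; apply: ler_sum_nat => k /andP[_ kn].
  rewrite ler_wpM2l ?exp_coeff_ge0// ler_wpM2l//.
  by rewrite lef_pV2 ?posrE// ler_nat.
apply: le_trans (ler_wpM2r yn0 IHn).
apply: (@le_trans _ _ (`|egf (series u) n + egf u n| * y ^+ n * (y / n.+1%:R))).
  rewrite /egf -mulrDl -seriesSr factS natrM invfM !normrM exprSr.
  rewrite [`|n.+1%:R^-1|]ger0_norm ?invr_ge0//.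
  by rewrite le_eqVlt; apply/orP; left; apply/eqP; ring.
rewrite ler_wpM2r//; apply: le_trans (lerD (lexx _) (uC n)).
by rewrite -[leRHS]mulrDl ler_wpM2r ?exprn_ge0// ler_normD.
Qed.

(** The terms are recovered from the partial sums as differences; conversely,
    [series u] is controlled by [u], and shifting it by one is a termwise
    derivative. *)
Lemma entire_egf_seriesS u :
  entire (egf (fun k => series u k.+1)) <-> entire (egf u).
Proof.
split=> [eS|eu].
  have -> : egf u = fun k => egf (fun k => series u k.+1) k - egf (series u) k.
    by apply/funext => k; rewrite /egf -mulrBl seriesSr addrAC subrr add0r.
  by apply: entireB => //; exact: entire_egf_shift.
by rewrite -pseries_diffs_egf; apply/entire_pseries_diffs/entire_egf_series.
Qed.

Lemma borel_series u x : entire (egf u) ->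
  borel (series u) x = borel (fun k => series u k.+1) x - borel u x.
Proof.
move=> eu; have eS := (entire_egf_seriesS u).2 eu.
rewrite /borel -lim_seriesB; [|exact: entire_cvg..].
congr (limn (series _)); apply/funext => k /=.
by rewrite !fctE /egf seriesSr; ring.
Qed.

(** * Borel sums of real series *)

(** L'Hopital's rule for [F / expR] at infinity.  Cauchy's mean value theorem on
    [[a, x]], with [a] so large that [dF / expR] is [e / 2]-close to [l] beyond
    it, compares [F x - F a] with [l * (expR x - expR a)]; what depends on [a]
    is killed by [expR (- x)]. *)
Lemma cvg_expRM_derive (F dF : R -> R) (l : R) :
  (forall x, is_derive x 1 F (dF x)) ->
  expR (- x) * dF x @[x --> +oo] --> l ->
  expR (- x) * F x @[x --> +oo] --> l.
Proof.
move=> FdF /cvgrPdist_lt wl; apply/cvgrPdist_lt => e e0.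
have e20 : 0 < e / 2 by rewrite divr_gt0.
have [x0 [_ x0P]] := wl _ e20.
pose a := x0 + 1.
pose K := F a - l * expR a.
have /cvgrPdist_lt Ke : expR (- x) * K @[x --> +oo] --> (0 * K : R).
  by apply: cvgM; [exact: cvgr_expR|exact: cvg_cst].
near=> x.
have ax : a < x by near: x; apply: nbhs_pinfty_gt; exact: num_real.
have en0 z : expR z != 0 :> R by rewrite gt_eqF ?expR_gt0.
have cE (f df : R -> R) : (forall x, is_derive x 1 f (df x)) ->
    {within `[a, x], continuous f}.
  move=> fdf; apply: continuous_subspaceT => z.
  by apply: differentiable_continuous; apply/derivable1_diffP; apply: ex_derive.
have [c /[!in_itv]/= /andP[ac cx] cP] := @cauchy_MVT R F dF expR expR a x ax
  (cE _ _ FdF) (cE _ _ (@is_derive_expR R)) (fun z _ => FdF z)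
  (fun z _ => is_derive_expR z) (fun z _ => en0 z).
have wc : `|l - dF c / expR c| < e / 2.
  by rewrite mulrC -expRN; apply: x0P; rewrite (lt_trans _ ac)// ltrDl.
have dE : F x = F a + dF c / expR c * (expR x - expR a).
  rewrite cP divfK; first ring.
  by rewrite subr_eq0 gt_eqF// ltr_expR.
have -> : l - expR (- x) * F x =
    (l - dF c / expR c) * (1 - expR (- x) * expR a) + (0 - expR (- x) * K).
  by rewrite dE /K expRN; field; rewrite !en0.
rewrite [e]splitr (le_lt_trans (ler_normD _ _))// ltrD//; last first.
  by rewrite -[X in X - _](mul0r K); near: x; exact: Ke.
rewrite normrM; apply: le_lt_trans wc; rewrite ler_piMr//.
rewrite -expRD ger0_norm ?gerBl ?expR_ge0// subr_ge0 -expR0 ler_expR.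
by rewrite addrC subr_le0 ltW.
Unshelve. all: by end_near. Qed.

Lemma continuous_borel u : entire (egf u) -> continuous (borel u).
Proof.
move=> eu x; apply: differentiable_continuous; apply/derivable1_diffP.
by have ? := is_derive_borel x eu; exact: ex_derive.
Qed.

Lemma continuous_expRN_borel u : entire (egf u) ->
  continuous (fun t => expR (- t) * borel u t).
Proof.
move=> eu t; apply: cvgM; last exact: continuous_borel.
apply: (@continuous_comp _ _ _ -%R); first exact: opp_continuous.
exact: continuous_expR.
Qed.

Lemma integrable_borel u x : entire (egf u) ->
  lebesgue_measure.-integrable `[0, x] (fun t => (expR (- t) * borel u t)%:E).
Proof.
move=> eu; apply: continuous_compact_integrable; first exact: segment_compact.
exact/continuous_subspaceT/continuous_expRN_borel.
Qed.

(** [expR (- t) * borel (series u) t] is a primitive of the integrand, and it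
    vanishes at 0. *)
Lemma Rintegral_borel u x : entire (egf u) -> 0 < x ->
  \int[lebesgue_measure]_(t in `[0, x]) (expR (- t) * borel u t) =
  expR (- x) * borel (fun k => series u k.+1) x - expR (- x) * borel u x.
Proof.
move=> eu x0; rewrite -mulrBr -borel_series//.
have eS := entire_egf_series eu.
pose F t := expR (- t) * borel (series u) t.
have dF (t : R) : is_derive t (1 : R) F (expR (- t) * borel u t).
  have dS := is_derive_borel t eS.
  have dE : is_derive t (1 : R) (fun t => expR (- t)) (- expR (- t)).
    by apply: (is_derive_eq (is_derive1_comp _ _)); rewrite mulrN1.
  apply: (is_derive_eq (is_deriveM dE dS)).
  rewrite borel_series// /GRing.scale/=; ring.
have cF : continuous F by exact: continuous_expRN_borel.
rewrite /Rintegral (@continuous_FTC2 _ _ F)//.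
- by rewrite /= /F {2}/borel pseries0 /egf /series /= big_nil mul0r mulr0 subr0.
- exact/continuous_subspaceT/continuous_expRN_borel.
- split=> [t _| |]; first exact: ex_derive.
    exact/cvg_at_right_filter/cF.
  exact/cvg_at_left_filter/cF.
- by move=> t _; rewrite derive1E derive_val.
Qed.
End PowerSeries.

(** * Borel sums of matrix series *)

Section Matrices.
Variables (R : realType) (d : nat).
Implicit Types (A : nat -> 'M[R[i]]_d) (S : 'M[R[i]]_d) (x : R) (i j : 'I_d).

(** One real-valued name for both coordinates of a complex number, so that each
    statement about entries is proved once. *)
Definition part (b : bool) (z : R[i]) : R :=
  if b then complex.Re z else complex.Im z.

Lemma part_sum b I (r : seq I) (F : I -> R[i]) :
  part b (\sum_(i <- r) F i) = \sum_(i <- r) part b (F i).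
Proof. by case: b; rewrite /part raddf_sum. Qed.

Lemma part_realM b (r : R) (z : R[i]) : part b (r%:C * z) = r * part b z.
Proof. by case: b z => -[u v] /=; rewrite !mul0r ?subr0 ?addr0. Qed.

Lemma cvg_mx_partP (I : Type) (F : set_system I) (FF : Filter F)
    (f : I -> 'M[R[i]]_d) S :
  f @ F --> S <-> forall i j b, part b (f x i j) @[x --> F] --> part b (S i j).
Proof.
split=> [/cvg_mxP fS i j b|fS].
  by have /cvg_complexP[? ?] := fS i j; case: b.
apply/cvg_mxP => i j; apply/cvg_complexP.
by split; [exact: (fS i j true)|exact: (fS i j false)].
Qed.

Lemma cvg_mx_part_near (I : Type) (F : set_system I) (FF : Filter F)
    (f : I -> 'M[R[i]]_d) (g : 'I_d -> 'I_d -> bool -> I -> R) S :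
  (forall i j b, \forall x \near F, part b (f x i j) = g i j b x) ->
  f @ F --> S <-> forall i j b, g i j b x @[x --> F] --> part b (S i j).
Proof.
move=> fg; rewrite cvg_mx_partP; split=> fS i j b; apply: cvg_trans (fS i j b).
  exact/near_eq_cvg/fg.
by apply: near_eq_cvg; apply: filterS (fg i j b) => x /esym.
Qed.

Definition coord A i j b : R^nat := fun k => part b (A k i j).

Lemma coord_partial_sum A i j b :
  coord (partial_sum A) i j b = fun k => series (coord A i j b) k.+1.
Proof.
apply/funext => k.
by rewrite /coord /partial_sum summxE part_sum /series/= big_mkord.
Qed.

Lemma part_borel_series A x i j b n :
  part b (series (borel_term A x) n i j) = pseries (egf (coord A i j b)) x n.
Proof.
rewrite /series /= summxE part_sum; apply: eq_bigr => k _.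
by rewrite mxE part_realM /egf /coord mulrC mulrA mulrAC.
Qed.

Lemma summable_mxP (u : nat -> 'M[R[i]]_d) :
  summable_mx u <-> forall i j b, cvgn (fun n => part b (series u n i j)).
Proof.
split=> [/cvg_mx_partP us i j b|us]; first by apply/cvg_ex; eexists; exact: us.
apply/cvg_ex; exists (\matrix_(i, j)
  (limn (fun n => part true (series u n i j)) +i*
   limn (fun n => part false (series u n i j)))).
apply/cvg_mx_partP => i j b; rewrite mxE.
by case: b; [exact: (us i j true)|exact: (us i j false)].
Qed.

Lemma part_sum_mx (u : nat -> 'M[R[i]]_d) i j b : summable_mx u ->
  part b (sum_mx u i j) = limn (fun n => part b (series u n i j)).
Proof. by move=> /cvg_mx_partP us; apply/esym/cvg_lim => //; exact: us. Qed.

Definition entire_mx A := forall i j b, entire (egf (coord A i j b)).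

Lemma summable_borel_termP A :
  (forall x, 0 < x -> summable_mx (borel_term A x)) <-> entire_mx A.
Proof.
have partE x i j b : (fun n => part b (series (borel_term A x) n i j)) =
    pseries (egf (coord A i j b)) x.
  by apply/funext => n; exact: part_borel_series.
split=> [As i j b|eA x _].
  by apply: cvg_entire => x /As /summable_mxP /(_ i j b); rewrite partE.
by apply/summable_mxP => i j b; rewrite partE; exact: entire_cvg.
Qed.

Lemma summable_mxZ (u : nat -> 'M[R[i]]_d) (c : R) : c != 0 ->
  summable_mx (fun k => c%:C *: u k) <-> summable_mx u.
Proof.
move=> c0; rewrite !summable_mxP.
have partE i j b : (fun n => part b (series (fun k => c%:C *: u k) n i j)) =
    c *: (fun n => part b (series u n i j)).
  by apply/funext => n; rewrite /series /= -scaler_sumr mxE; exact: part_realM.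
by split=> us i j b; have := us i j b; rewrite partE is_cvgZrE.
Qed.

Lemma part_sum_borel A x i j b : entire_mx A ->
  part b (sum_mx (borel_term A x) i j) = borel (coord A i j b) x.
Proof.
move=> eA; rewrite part_sum_mx.
  by congr (limn _); apply/funext => n; exact: part_borel_series.
(* [summable_borel_termP] only reaches positive points; at 0 and below the
   convergence comes from the coefficient bound itself. *)
apply/summable_mxP => i' j' b'.
under eq_fun do rewrite part_borel_series.
exact: entire_cvg.
Qed.

Lemma entire_partial_sum A : entire_mx (partial_sum A) <-> entire_mx A.
Proof.
split=> eA i j b; have := eA i j b; rewrite coord_partial_sum;
  by move/entire_egf_seriesS.
Qed.

(** At each fixed [x] the factor [e^(-x)] is a nonzero constant, so it does not
    affect the convergence of the series. *)
Lemma weakly_borel_summableP A S : weakly_borel_summable A S <->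
  entire_mx A /\ forall i j b,
    expR (- x) * borel (fun k => series (coord A i j b) k.+1) x @[x --> +oo]
      --> part b (S i j).
Proof.
have summableP : (forall x, 0 < x -> summable_mx
     (fun k => (expR (- x))%:C *: borel_term (partial_sum A) x k)) <-> entire_mx A.
  rewrite -entire_partial_sum -summable_borel_termP.
  have scaleP x := summable_mxZ (borel_term (partial_sum A) x)
    (lt0r_neq0 (expR_gt0 (- x))).
  split=> h x x0; first exact: (scaleP x).1 (h x x0).
  exact: (scaleP x).2 (h x x0).
have weakE (eA : entire_mx A) i j b : \forall x \near +oo,
    part b (((expR (- x))%:C *: weak_borel A x) i j) =
    expR (- x) * borel (fun k => series (coord A i j b) k.+1) x.
  apply: nearW => x; rewrite mxE part_realM part_sum_borel.
    by rewrite coord_partial_sum.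
  exact/entire_partial_sum.
rewrite /weakly_borel_summable summableP; split=> -[eA wA]; split=> //.
  exact: (cvg_mx_part_near _ S (weakE eA)).1 wA.
exact: (cvg_mx_part_near _ S (weakE eA)).2 wA.
Qed.

Lemma part_expR_strong_borel A x i j b : entire_mx A ->
  part b (((expR (- x))%:C *: strong_borel A x) i j) =
  expR (- x) * borel (coord A i j b) x.
Proof. by move=> eA; rewrite mxE part_realM part_sum_borel. Qed.

Lemma integrable_strong_borel A x : entire_mx A ->
  integrable_mx `[0, x] (fun t => (expR (- t))%:C *: strong_borel A t).
Proof.
move=> eA i j.
have int b : lebesgue_measure.-integrable `[0, x]
    (fun t => (part b (((expR (- t))%:C *: strong_borel A t) i j))%:E).
  have -> : (fun t => (part b (((expR (- t))%:C *: strong_borel A t) i j))%:E) =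
      fun t => (expR (- t) * borel (coord A i j b) t)%:E.
    by apply/funext => t; rewrite part_expR_strong_borel.
  exact: integrable_borel.
by split; [exact: (int true)|exact: (int false)].
Qed.

Lemma part_integral_strong_borel A x i j b : entire_mx A -> 0 < x ->
  part b (integral_mx `[0, x]
    (fun t => (expR (- t))%:C *: strong_borel A t) i j) =
  expR (- x) * borel (fun k => series (coord A i j b) k.+1) x
    - expR (- x) * borel (coord A i j b) x.
Proof.
move=> eA x0; rewrite -Rintegral_borel//.
have -> : part b (integral_mx `[0, x]
      (fun t => (expR (- t))%:C *: strong_borel A t) i j) =
    \int[lebesgue_measure]_(t in `[0, x])
      part b (((expR (- t))%:C *: strong_borel A t) i j).
  by rewrite mxE; case: b.
by apply: eq_Rintegral => t _; exact: part_expR_strong_borel.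
Qed.

(** Integrability is automatic, the integrand being continuous; and the integral
    formula, valid for positive [x], determines the limit at infinity. *)
Lemma strongly_borel_summableP A S : strongly_borel_summable A S <->
  entire_mx A /\ forall i j b,
    expR (- x) * borel (fun k => series (coord A i j b) k.+1) x
      - expR (- x) * borel (coord A i j b) x @[x --> +oo] --> part b (S i j).
Proof.
have intE (eA : entire_mx A) i j b : \forall x \near +oo,
    part b (integral_mx `[0, x]
      (fun t => (expR (- t))%:C *: strong_borel A t) i j) =
    expR (- x) * borel (fun k => series (coord A i j b) k.+1) x
      - expR (- x) * borel (coord A i j b) x.
  apply: filterS (nbhs_pinfty_gt (num_real 0)) => x x0.
  exact: part_integral_strong_borel.
split=> [[/summable_borel_termP eA _ iS]|[eA iS]].
  by split=> //; exact: (cvg_mx_part_near _ S (intE eA)).1 iS.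
split; first exact/summable_borel_termP.
  by move=> x _; exact: integrable_strong_borel.
exact: (cvg_mx_part_near _ S (intE eA)).2 iS.
Qed.

Lemma strong_borel_cvg0P A : entire_mx A ->
  (expR (- x))%:C *: strong_borel A x @[x --> +oo] --> (0 : 'M[R[i]]_d) <->
  forall i j b, expR (- x) * borel (coord A i j b) x @[x --> +oo] --> (0 : R).
Proof.
move=> eA.
have strongE i j b : \forall x \near +oo,
    part b (((expR (- x))%:C *: strong_borel A x) i j) =
    expR (- x) * borel (coord A i j b) x.
  by apply: nearW => x; exact: part_expR_strong_borel.
have part0 i j b : part b ((0 : 'M[R[i]]_d) i j) = 0 by rewrite mxE; case: b.
split=> A0; last first.
  by apply: (cvg_mx_part_near _ 0 strongE).2 => i j b; rewrite part0; exact: A0.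
move=> i j b; rewrite -(part0 i j b).
exact: (cvg_mx_part_near _ 0 strongE).1 A0 i j b.
Qed.
End Matrices.

Theorem theorem4p15 (R : realType) (d : nat)
    (A : nat -> 'M[R[i]]_d) (S : 'M[R[i]]_d) :
  (weakly_borel_summable A S -> strongly_borel_summable A S) /\
  (strongly_borel_summable A S ->
     (weakly_borel_summable A S <->
      (expR (- x))%:C *: strong_borel A x @[x --> +oo] --> (0 : 'M[R[i]]_d))).
Proof.
split=> [/weakly_borel_summableP[eA wS]|/strongly_borel_summableP[eA sS]].
  apply/strongly_borel_summableP; split=> // i j b.
  have eS := entire_egf_series (eA i j b).
  have := cvg_expRM_derive (fun x => is_derive_borel x eS) (wS i j b).
  by under eq_fun do rewrite borel_series// mulrBr.
rewrite strong_borel_cvg0P//; split=> [/weakly_borel_summableP[_ wS]|B0].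
  move=> i j b; rewrite -(subrr (part b (S i j))).
  apply: cvg_trans (cvgB (wS i j b) (sS i j b)).
  by apply: near_eq_cvg; apply: nearW => x /=; rewrite !fctE; ring.
apply/weakly_borel_summableP; split=> // i j b.
rewrite -[part b _]addr0; apply: cvg_trans (cvgD (sS i j b) (B0 i j b)).
by apply: near_eq_cvg; apply: nearW => x /=; rewrite !fctE; ring.
Qed.
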